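(* Let $v\in\{0,1\}^n$ ($n\ge1$) be a binary vector and let $N$ be a positive integer. Then the Collatz sequence of first term $N$ and length $n$ has $v$ as its parity vector, i.e. $v_n(N)=v$, if and only if $g_v(N)\in\mathbb{N}$. Moreover, in this case $T^{n}(N)=g_v(N)$.
   Context: The Collatz map $T$ on positive integers is $T(N)=N/2$ if $N$ is even and $T(N)=(3N+1)/2$ if $N$ is odd. For an integer $N$ let $\mathbf{i}(N)=0$ if $N$ is even and $1$ if $N$ is odd, and for a positive integer $N$ put $v_n(N)=(\mathbf{i}(N),\mathbf{i}(T(N)),\ldots,\mathbf{i}(T^{n-1}(N)))$. For $v=(e_1,\ldots,e_n)\in\{0,1\}^n$, let $m(v)=\sum_{i=1}^n e_i$, let $j_1<j_2<\cdots<j_{m}$ ($m=m(v)$) be the positions $i$ with $e_i=1$, and put $P(v)=\sum_{k=1}^{m}3^{m-k}2^{j_k-1}$ (so $P(v)=0$ if $m=0$). The function $g_v$ is defined on positive integers by $g_v(N)=\dfrac{3^{m(v)}}{2^{n}}N+\dfrac{P(v)}{2^{n}}$. *)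

(* Defs.v *)
From mathcomp Require Import all_boot all_order all_algebra.

Set Implicit Arguments.
Unset Strict Implicit.
Unset Printing Implicit Defensive.

(* Intended on positive integers, which it preserves; collatz 0 = 0 is a junk value. *)
Definition collatz (N : nat) : nat := if odd N then (3 * N + 1) %/ 2 else N %/ 2.

(* Bits are booleans, so that the parity function is [odd]. *)
Definition parity_vector (n N : nat) : n.-tuple bool :=
  [tuple odd (iter i collatz N) | i < n].

Definition ones (n : nat) (v : n.-tuple bool) : nat := \sum_(i < n) tnth v i.

(* The increasing list [:: j_1; ...; j_m] of the positions, counted from 1. *)
Definition positions (n : nat) (v : n.-tuple bool) : seq nat :=
  [seq i <- iota 1 n | nth false v i.-1].

Definition pos (n : nat) (v : n.-tuple bool) (k : nat) : nat :=
  nth 0 (positions v) k.-1.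

Definition Pv (n : nat) (v : n.-tuple bool) : nat :=
  \sum_(1 <= k < (ones v).+1) 3 ^ (ones v - k) * 2 ^ (pos v k - 1).

Definition gv (n : nat) (v : n.-tuple bool) (N : nat) : rat :=
  ((3 ^+ ones v / 2 ^+ n) * N%:R + (Pv v)%:R / 2 ^+ n)%R.

(* Main.v *)
Require Import Defs.
From mathcomp Require Import all_boot all_order all_algebra.
From mathcomp Require Import zify.

(** Clearing the denominator of [gv v N] gives the natural number
    A(v, N) = 3 ^ m(v) * N + P(v), so that integrality of [gv v N] means
    2 ^ n %| A(v, N).  Both claims follow by induction on the vector, removing
    its first bit, because A depends on that bit b in a rigid way: for
    v = b :: w,
    - if b is the parity of N, then A(v, N) = 2 * A(w, T(N))
      ([affine_num_match]);
    - if b is not the parity of N, then A(v, N) is odd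
      ([odd_affine_num_mismatch]).
    Matching parities thus let one factor 2 out at every step, which yields
    A(v, N) = 2 ^ n * T^n(N); conversely a factor 2 in A(v, N) forces the first
    bit to be right, and dividing by it passes the hypothesis on to w and T(N).
    The induction needs P in a form recursive in the first bit: prefixing a bit
    shifts all later positions by one, that is, doubles their contribution to
    P ([Pv_Pseq]). *)

Fixpoint Pseq (s : seq bool) : nat :=
  if s is b :: s' then b * 3 ^ count id s' + 2 * Pseq s' else 0.

Definition affine_num (s : seq bool) (N : nat) : nat :=
  3 ^ count id s * N + Pseq s.

Definition bit_positions (s : seq bool) : seq nat :=
  [seq i <- iota 1 (size s) | nth false s i.-1].

(** The sum defining P, taken over an arbitrary list of positions, so that
    shifting the list and prefixing the position 1 can be treated apart. *)
Definition weight (p : seq nat) : nat :=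
  \sum_(k < size p) 3 ^ (size p - k.+1) * 2 ^ (nth 0 p k - 1).

Lemma bit_positions_cons (b : bool) (s : seq bool) :
  bit_positions (b :: s) = nseq b 1 ++ map S (bit_positions s).
Proof.
rewrite /bit_positions /= (iotaDl 1 1) filter_map.
have -> : [seq i <- iota 1 (size s)
             | preim (addn 1) (fun i => nth false (b :: s) i.-1) i]
        = [seq i <- iota 1 (size s) | nth false s i.-1].
  by apply: eq_in_filter => -[|i]; rewrite mem_iota.
by case: b.
Qed.

Lemma size_bit_positions (s : seq bool) : size (bit_positions s) = count id s.
Proof.
elim: s => [|b s IHs] //.
by rewrite bit_positions_cons size_cat size_nseq size_map IHs.
Qed.

(** Positivity matters because the exponents [j - 1] are truncated: a position
    0 would not be doubled by the shift. *)
Lemma weight_shift (p : seq nat) :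
  all (leq 1) p -> weight (map S p) = 2 * weight p.
Proof.
move=> /all_nthP p_gt0; rewrite /weight size_map big_distrr /=.
apply: eq_bigr => k _; rewrite (nth_map 0) // subSS subn0 mulnCA -expnS.
by rewrite subn1 prednK // p_gt0.
Qed.

Lemma weight_cons1 (p : seq nat) : weight (1 :: p) = 3 ^ size p + weight p.
Proof.
by rewrite /weight big_ord_recl /= subSS subn0 muln1; congr (_ + _).
Qed.

Lemma weight_bit_positions (s : seq bool) : weight (bit_positions s) = Pseq s.
Proof.
elim: s => [|b s IHs]; first by rewrite /weight big_ord0.
have pos_gt0 : all (leq 1) (bit_positions s).
  by apply/allP => i; rewrite mem_filter mem_iota => /and3P[].
rewrite bit_positions_cons; case: b => /=; last by rewrite weight_shift // IHs.
by rewrite weight_cons1 weight_shift // size_map size_bit_positions IHs mul1n.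
Qed.

Lemma ones_count (n : nat) (v : n.-tuple bool) : ones v = count id v.
Proof. by rewrite /ones -sumn_count sumnE big_map big_tuple. Qed.

Lemma Pv_Pseq (n : nat) (v : n.-tuple bool) : Pv v = Pseq v.
Proof.
rewrite -weight_bit_positions /weight size_bit_positions /Pv ones_count.
rewrite big_add1 big_mkord; apply: eq_bigr => k _.
by rewrite /pos /positions /bit_positions size_tuple.
Qed.

Lemma affine_num_match (s : seq bool) (N : nat) :
  affine_num (odd N :: s) N = 2 * affine_num s (collatz N).
Proof.
rewrite /affine_num /collatz /=; case: (boolP (odd N)) => oddN.
  have : 2 * ((3 * N + 1) %/ 2) = 3 * N + 1 by lia.
  by rewrite expnS; nia.
have : 2 * (N %/ 2) = N by lia.
by rewrite add0n mul0n; nia.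
Qed.

(** Modulo 2 the number [affine_num (b :: s) N] is N + b, powers of 3 being
    odd. *)
Lemma odd_affine_num_mismatch (b : bool) (s : seq bool) (N : nat) :
  odd N != b -> odd (affine_num (b :: s) N).
Proof.
rewrite /affine_num /= mul2n !oddD odd_double !oddM !oddX !orbT.
rewrite andbT oddb addbF.
by case: b (odd N) => [] [].
Qed.

Definition parity_seq (n N : nat) : seq bool :=
  [seq odd (iter i collatz N) | i <- iota 0 n].

Lemma parity_seqS (n N : nat) :
  parity_seq n.+1 N = odd N :: parity_seq n (collatz N).
Proof.
rewrite /parity_seq /= (iotaDl 1 0) -map_comp; congr (_ :: _).
by apply: eq_map => i /=; rewrite -iterS iterSr.
Qed.

Lemma parity_vector_seq (n N : nat) :
  parity_vector n N = parity_seq n N :> seq bool.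
Proof. by rewrite /= /parity_seq -val_enum_ord -map_comp. Qed.

Lemma affine_num_parity_seq (n N : nat) :
  affine_num (parity_seq n N) N = 2 ^ n * iter n collatz N.
Proof.
elim: n N => [|n IHn] N; first by rewrite /affine_num /= addn0.
by rewrite parity_seqS affine_num_match IHn mulnA -expnS iterSr.
Qed.

Lemma dvdn_affine_num (s : seq bool) (N : nat) :
  2 ^ size s %| affine_num s N -> parity_seq (size s) N = s.
Proof.
elim: s N => [|b s IHs] N //= dvd_num.
have [Nb|/odd_affine_num_mismatch odd_num] := eqVneq (odd N) b.
  move: dvd_num; rewrite parity_seqS -Nb affine_num_match expnS.
  by rewrite dvdn_pmul2l // => /IHs ->.
have : 2 %| affine_num (b :: s) N.
  by apply: dvdn_trans dvd_num; rewrite expnS dvdn_mulr.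
by rewrite dvdn2 odd_num.
Qed.

Lemma gv_affine_num (n : nat) (v : n.-tuple bool) (N : nat) :
  gv v N = ((affine_num v N)%:R / (2 ^ n)%:R)%R.
Proof.
rewrite /gv Pv_Pseq ones_count /affine_num.
by rewrite GRing.natrD GRing.natrM !GRing.natrX GRing.mulrDl GRing.mulrAC.
Qed.

Theorem theorem4p5 (n : nat) (hn : 1 <= n) (v : n.-tuple bool)
    (N : nat) (hN : 0 < N) :
  (parity_vector n N = v <-> gv v N \is a Num.nat) /\
  (parity_vector n N = v -> ((iter n collatz N)%:R = gv v N)%R).
Proof.
have pow2_neq0 : ((2 ^ n)%:R != 0 :> rat)%R.
  by rewrite Num.Theory.pnatr_eq0 expn_eq0.
have iter_gv : parity_vector n N = v -> ((iter n collatz N)%:R = gv v N)%R.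
  move=> <-; rewrite gv_affine_num parity_vector_seq affine_num_parity_seq.
  by rewrite GRing.natrM GRing.mulrAC GRing.divff // GRing.mul1r.
split=> //; split=> [/iter_gv <-|]; first exact: Num.Theory.natr_nat.
case/Num.Theory.natrP => q; rewrite gv_affine_num.
move=> /(canRL (GRing.divfK pow2_neq0)).
rewrite -GRing.natrM => /eqP; rewrite Num.Theory.eqr_nat => /eqP numE.
apply: val_inj; rewrite /= -/(val (parity_vector n N)).
have := @dvdn_affine_num v N; rewrite size_tuple numE dvdn_mull // => /(_ isT) <-.
exact: parity_vector_seq.
Qed.
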